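(* For all real numbers $[a],[b],[c]\in\mathcal{S}_{\mathbb{R}}$: if $[a]\le[b]$ and $[b]\le[c]$ then $[a]\le[c]$.
   Context: Conventions. $\omega=\{0,1,2,\dots\}$, $\omega_+=\omega\setminus\{0\}$, $[a,b]_\omega=\{n\in\omega:a\le n\le b\}$, $[a,\infty]_\omega=\{n\in\omega:n\ge a\}$. A system function $\vartheta:\omega_+\to[2,\infty]_\omega$ is fixed. Contractions. For $f:\omega\to\omega$ and $n\in\omega_+$, the contraction $c_n$ is applicable to $f$ iff $f(n+1)\ge\vartheta(n)$, and then $c_n(f)(n)=f(n)+1$, $c_n(f)(n+1)=f(n+1)-\vartheta(n)$, $c_n(f)(k)=f(k)$ for other $k$. A sequence of contractions is a finite (possibly empty) composition of contractions; it is applicable to $f$ iff each contraction in turn is applicable to the result of the preceding ones. Sign. For $f:\omega\to\omega$, $\sigma(f)=0$ if $f(0)$ is odd and $\sigma(f)=1$ if $f(0)$ is even. Auxiliary functions. $h:\omega\to\omega$ is a primary auxiliary function ($h\in A_p$) if $h(k)<\vartheta(k-1)$ for all $k\ge2$ and for every $N\in\omega_+$ there is $M\ge N+1$ with $h(M)\ne\vartheta(M-1)-1$. It is a secondary auxiliary function ($h\in A_s$) if $h(k)<\vartheta(k-1)$ for all $k\ge2$ and there is $N\in\omega_+$ with $h(M)=\vartheta(M-1)-1$ for all $M\ge N+1$; the least such $N$ is $N^h_{\min}$. Base set. $W_1$ is the set of pairs $(h_p,h_s)\in A_p\times A_s$ such that, with $N=N^{h_s}_{\min}$, $h_p(k)=h_s(k)$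 for $k<N$, $h_p(N)=h_s(N)+1$, and $h_p(k)=0$ for $k>N$. Two pairs in $W_1$ are equivalent if their first components agree on $\omega_+$ and have the same sign; $F$ is the collection of sets obtained by taking, for each equivalence class, the set of all functions that are components of its pairs. $W_2$ is the set of primary auxiliary functions occurring in no pair of $W_1$; two elements of $W_2$ are equivalent if they agree on $\omega_+$ and have the same sign; $G_2$ is the set of equivalence classes. The base set is $B=F\cup G_2$. Real numbers. For $b\in B$, $r_b$ is the set of $f:\omega\to\omega$ for which there is $h\in b$ such that for every $N\in\omega_+$ some sequence of contractions $\mathcal{C}$ applicable to $f$ satisfies $\mathcal{C}(f)(n)=h(n)$ for all $n\in[0,N]_\omega$. Let $b_1,b_2\in B$ be the elements containing respectively the zero function, and the function with value $1$ at $0$ and $0$ elsewhere. $\mathcal{S}_{\mathbb{R}}$ (the set of real numbers) consists of all $r_b$ with $b\in B\setminus\{b_1,b_2\}$ together with $[0]:=r_{b_1}\cup r_{b_2}$. Put $\mathcal{S}_{\mathbb{R}}^*=\mathcal{S}_{\mathbb{R}}\setminus\{[0]\}$. Distinct real numbers are disjoint. A function lying in some real number is called finite, and $[f]$ denotes the real number containing $f$. For $[a]\in\mathcal{S}_{\mathbb{R}}^*$ all elements have the same sign, denoted $\sigma([a])$. Order. For $[a],[b]\in\mathcal{S}_{\mathbb{R}}^*$, $[a]\le[b]$ iff one of the following holds: (i) $\sigma([a])<\sigma([b])$; (ii) $\sigma([a])=\sigma([b])=1$ and for every $a\in[a]$ there is $b\in[b]$ with $a(n)\le b(n)$ for all $n\in\omega_+$;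 (iii) $\sigma([a])=\sigma([b])=0$ and for every $b\in[b]$ there is $a\in[a]$ with $a(n)\ge b(n)$ for all $n\in\omega_+$. For $[a]\in\mathcal{S}_{\mathbb{R}}^*$, $[a]\le[0]$ iff $\sigma([a])=0$, and $[0]\le[a]$ iff $\sigma([a])=1$. Finally $[0]\le[0]$ holds. *)

(* Defs.v *)
From mathcomp Require Import all_boot all_classical.

Set Implicit Arguments.
Unset Strict Implicit.
Unset Printing Implicit Defensive.

Local Open Scope classical_set_scope.

(* A system function omega_+ -> [2, oo[ is represented by a function on nat;
   its value at 0 is never used. *)
Definition system_function (theta : nat -> nat) : Prop :=
  forall n, 0 < n -> 2 <= theta n.

Definition contraction (theta : nat -> nat) (n : nat) (f : nat -> nat) :
    nat -> nat :=
  fun k => if k == n then (f n).+1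
           else if k == n.+1 then f n.+1 - theta n
           else f k.

(* A sequence of contractions is given by the list of its indices, the head
   being applied first. *)
Fixpoint applicable (theta : nat -> nat) (s : seq nat) (f : nat -> nat) :
    Prop :=
  if s is n :: s' then
    [/\ 0 < n, theta n <= f n.+1 & applicable theta s' (contraction theta n f)]
  else True.

Fixpoint contractions (theta : nat -> nat) (s : seq nat) (f : nat -> nat) :
    nat -> nat :=
  if s is n :: s' then contractions theta s' (contraction theta n f) else f.

Definition fun_sign (f : nat -> nat) : nat := if odd (f 0) then 0 else 1.

Definition digits_bounded (theta h : nat -> nat) : Prop :=
  forall k, 2 <= k -> h k < theta k.-1.

Definition maximal_after (theta h : nat -> nat) (N : nat) : Prop :=
  forall M, N.+1 <= M -> h M = (theta M.-1).-1.

Definition primary_aux (theta : nat -> nat) : set (nat -> nat) :=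
  [set h | digits_bounded theta h /\
    forall N, 0 < N -> exists2 M, N.+1 <= M & h M <> (theta M.-1).-1].

Definition secondary_aux (theta : nat -> nat) : set (nat -> nat) :=
  [set h | digits_bounded theta h /\
    exists2 N, 0 < N & maximal_after theta h N].

(* The least N exists, and is thus the element selected by [get], as soon as
   h is a secondary auxiliary function. *)
Definition Nmin (theta h : nat -> nat) : nat :=
  [get N : nat | [/\ 0 < N, maximal_after theta h N &
    forall N', 0 < N' -> maximal_after theta h N' -> N <= N']].

Definition W1 (theta : nat -> nat) : set ((nat -> nat) * (nat -> nat)) :=
  [set p | [/\ primary_aux theta p.1, secondary_aux theta p.2 &
    let N := Nmin theta p.2 in
    [/\ forall k, k < N -> p.1 k = p.2 k,
        p.1 N = (p.2 N).+1 &
        forall k, N < k -> p.1 k = 0]]].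

Definition fun_equiv (f g : nat -> nat) : Prop :=
  (forall n, 0 < n -> f n = g n) /\ fun_sign f = fun_sign g.

Definition W1_class (theta : nat -> nat) (p : (nat -> nat) * (nat -> nat)) :
    set ((nat -> nat) * (nat -> nat)) :=
  [set q | W1 theta q /\ fun_equiv p.1 q.1].

Definition components (C : set ((nat -> nat) * (nat -> nat))) :
    set (nat -> nat) :=
  [set h | exists2 q, C q & h = q.1 \/ h = q.2].

Definition F_base (theta : nat -> nat) : set (set (nat -> nat)) :=
  [set components (W1_class theta p) | p in W1 theta].

Definition W2 (theta : nat -> nat) : set (nat -> nat) :=
  [set h | primary_aux theta h /\
    forall p, W1 theta p -> h <> p.1 /\ h <> p.2].

Definition W2_class (theta h : nat -> nat) : set (nat -> nat) :=
  [set g | W2 theta g /\ fun_equiv h g].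

Definition G2_base (theta : nat -> nat) : set (set (nat -> nat)) :=
  [set W2_class theta h | h in W2 theta].

Definition base_set (theta : nat -> nat) : set (set (nat -> nat)) :=
  F_base theta `|` G2_base theta.

Definition real_of (theta : nat -> nat) (b : set (nat -> nat)) :
    set (nat -> nat) :=
  [set f | exists2 h, b h & forall N, 0 < N ->
    exists2 s, applicable theta s f &
      forall n, n <= N -> contractions theta s f n = h n].

(* Used only for functions h lying in exactly one element of the base set. *)
Definition base_containing (theta h : nat -> nat) : set (nat -> nat) :=
  [get b : set (nat -> nat) | base_set theta b /\ b h].

Definition b1 (theta : nat -> nat) : set (nat -> nat) :=
  base_containing theta (fun _ => 0).

Definition b2 (theta : nat -> nat) : set (nat -> nat) :=
  base_containing theta (fun n => if n == 0 then 1 else 0).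

Definition real_zero (theta : nat -> nat) : set (nat -> nat) :=
  real_of theta (b1 theta) `|` real_of theta (b2 theta).

Definition reals (theta : nat -> nat) : set (set (nat -> nat)) :=
  [set real_of theta b | b in base_set theta `\` [set b1 theta; b2 theta]]
    `|` [set real_zero theta].

Definition nonzero_reals (theta : nat -> nat) : set (set (nat -> nat)) :=
  reals theta `\` [set real_zero theta].

(* The common sign of the elements of a nonzero real number. *)
Definition real_sign (x : set (nat -> nat)) : nat :=
  [get s : nat | forall f, x f -> fun_sign f = s].

Definition le_nonzero (x y : set (nat -> nat)) : Prop :=
  [\/ real_sign x < real_sign y,
      [/\ real_sign x = 1, real_sign y = 1 &
        forall a, x a -> exists2 b, y b & forall n, 0 < n -> a n <= b n] |
      [/\ real_sign x = 0, real_sign y = 0 &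
        forall b, y b -> exists2 a, x a & forall n, 0 < n -> b n <= a n]].

Definition real_le (theta : nat -> nat) (x y : set (nat -> nat)) : Prop :=
  [\/ [/\ nonzero_reals theta x, nonzero_reals theta y & le_nonzero x y],
      [/\ nonzero_reals theta x, y = real_zero theta & real_sign x = 0],
      [/\ x = real_zero theta, nonzero_reals theta y & real_sign y = 1] |
      x = real_zero theta /\ y = real_zero theta].

(* Main.v *)
Require Import Defs.
From mathcomp Require Import all_boot all_classical.

(** Transitivity of the order is formal except when [0] <= [b] <= [c] with [b]
    and [c] nonzero: there the sign of [c] must be at most 1, which rests on
    every nonzero real number being inhabited. *)

Lemma fun_sign_le1 (f : nat -> nat) : fun_sign f <= 1.
Proof. by rewrite /fun_sign; case: ifP. Qed.

Lemma fun_equiv_refl (f : nat -> nat) : fun_equiv f f.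
Proof. by []. Qed.

Lemma base_set_nonempty (theta : nat -> nat) (b : set (nat -> nat)) :
  base_set theta b -> exists h, b h.
Proof.
case=> [[p W1p <-]|[h W2h <-]].
- exists p.1; exists p; last by left.
  by split=> //; exact: fun_equiv_refl.
- by exists h; split=> //; exact: fun_equiv_refl.
Qed.

(** Each [h] in [b] represents its own real number: the empty sequence of contractions already gives
    [h] for every [N]. *)
Lemma real_of_nonempty (theta : nat -> nat) (b : set (nat -> nat)) :
  base_set theta b -> exists f, real_of theta b f.
Proof.
move=> /base_set_nonempty[h bh]; exists h; exists h => // N _.
by exists [::].
Qed.

Lemma nonzero_reals_nonempty (theta : nat -> nat) (x : set (nat -> nat)) :
  nonzero_reals theta x -> exists f, x f.
Proof.
case=> -[[b [Bb _] <-] _|-> /(_ erefl) //].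
exact: real_of_nonempty.
Qed.

(* If the elements of x had no common sign, [get] would return the default
   value 0 of nat. *)
Lemma real_sign_le1 (x : set (nat -> nat)) (f : nat -> nat) :
  x f -> real_sign x <= 1.
Proof.
move=> xf; rewrite /real_sign; case: xgetP => [s _ /(_ f xf) <-|//].
exact: fun_sign_le1.
Qed.

(** A strict increase of sign at either step survives, since the other step never lowers the sign.
    Otherwise all signs agree and pointwise bounds compose. *)
Lemma le_nonzero_trans (x y z : set (nat -> nat)) :
  le_nonzero x y -> le_nonzero y z -> le_nonzero x z.
Proof.
case=> [xy|[sx sy xy]|[sx sy xy]]; case=> [yz|[sy' sz yz]|[sy' sz yz]].
- by constructor 1; exact: ltn_trans yz.
- by constructor 1; rewrite sz -sy'.
- by constructor 1; rewrite sz -sy'.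
- by constructor 1; rewrite sx -sy.
- constructor 2; split=> // f /xy[g /yz[h zh gh] fg].
  by exists h => // n n0; exact: leq_trans (fg n n0) (gh n n0).
- by rewrite sy in sy'.
- by constructor 1; rewrite sx -sy.
- by rewrite sy in sy'.
(* For negative numbers the witnesses are chosen backwards, from [z] through [y] to [x]. *)
- constructor 3; split=> // h /yz[g /xy[f xf fg] gh].
  by exists f => // n n0; exact: leq_trans (gh n n0) (fg n n0).
Qed.

(** Settles the cases where exactly one of the outer numbers is zero. *)
Lemma le_nonzero_sign (x y : set (nat -> nat)) :
  le_nonzero x y -> real_sign x <= real_sign y.
Proof. by case=> [/ltnW|[-> ->]|[-> ->]]. Qed.

Theorem mainTheorem4 (theta : nat -> nat) (htheta : system_function theta)
    (a b c : set (nat -> nat))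
    (ha : reals theta a) (hb : reals theta b) (hc : reals theta c)
    (hab : real_le theta a b) (hbc : real_le theta b c) :
  real_le theta a c.
Proof.
case: hab => [[na nb ab]|[na b0 sa]|[a0 nb sb]|[a0 b0]];
  case: hbc => [[nb' nc bc]|[nb' c0 sb']|[b0' nc sc]|[b0' c0]];
  (* Discards the combinations that make [b] both zero and nonzero; eight of sixteen remain. *)
  try (by case: nb => _ /(_ b0')); try (by case: nb' => _ /(_ b0)).
- by constructor 1; split=> //; exact: le_nonzero_trans bc.
- constructor 2; split=> //; apply/eqP.
  by rewrite -leqn0 -sb'; exact: le_nonzero_sign.
- by constructor 1; split=> //; constructor 1; rewrite sa sc.
- by constructor 2.
- constructor 3; split=> //; apply/eqP; rewrite eqn_leq.
  have [f cf] := nonzero_reals_nonempty _ _ nc.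
  by rewrite (real_sign_le1 _ _ cf) -{1}sb le_nonzero_sign.
(* Here [b] would lie on both sides of zero, with sign 1 and sign 0. *)
- by rewrite sb in sb'.
- by constructor 3.
- by constructor 4.
Qed.
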